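(* Let $F:\mathbb{R}^n\to\mathbb{R}$ be a convex $C^2$ function having a unique minimizer $x^*$ and satisfying $\mathcal{G}_\mu^2$ for some $\mu>0$; let $F^*=F(x^* )$. Let $x$ be a solution of (DIN-AVD) for all $t\geq t_0$, where $t_0>0$, $\alpha\geq 3$ and $\beta>0$. Then, for any $\varepsilon\in(0,1)$, as $t\to+\infty$, $$F(x(t))-F^*=\mathcal{O}\left(t^{-\alpha+\varepsilon}\right),$$ and $$\int_{t_0}^{+\infty}u^{\alpha-\varepsilon}\left(F(x(u))-F^*\right)du<+\infty.$$
   Context: $\mathbb{R}^n$ carries the Euclidean inner product and norm; $d(x,X)=\inf_{y\in X}\|x-y\|$. $H_F$ denotes the Hessian of $F$. (DIN-AVD) is the ODE $$\ddot x(t)+\frac{\alpha}{t}\dot x(t)+\beta H_F(x(t))\dot x(t)+\nabla F(x(t))=0,\qquad t\geq t_0,$$ with $t_0>0$ and initial conditions $x(t_0)\in\mathbb{R}^n$, $\dot x(t_0)=0$. A convex differentiable $F:\mathbb{R}^n\to\mathbb{R}$ with nonempty set of minimizers $X^*$ and minimum value $F^*$ satisfies $\mathcal{G}_\mu^2$ ($\mu>0$) if $\frac{\mu}{2}d(x,X^* )^2\leq F(x)-F^*$ for all $x\in\mathbb{R}^n$. *)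

(* Defs.v *)
From mathcomp Require Import all_boot all_order all_algebra.
From mathcomp Require Import all_classical all_reals all_analysis.
Set Implicit Arguments.
Unset Strict Implicit.
Unset Printing Implicit Defensive.
Import Order.TTheory GRing.Theory Num.Theory.
Import numFieldNormedType.Exports.
Local Open Scope classical_set_scope.
Local Open Scope ring_scope.

(* The library norm on ['rV[R]_n] is the sup norm. *)
Definition eucl_norm (R : realType) (n : nat) (x : 'rV[R]_n) : R :=
  Num.sqrt (\sum_(i < n) x 0 i ^+ 2).

Definition eucl_dist_set (R : realType) (n : nat) (x : 'rV[R]_n)
    (X : set 'rV[R]_n) : R :=
  inf [set eucl_norm (x - y) | y in X].

Definition gradient (R : realType) (n : nat) (F : 'rV[R]_n -> R)
    (x : 'rV[R]_n) : 'rV[R]_n :=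
  \row_(i < n) 'D_(delta_mx 0 i) F x.

(* The (i, j) entry is the derivative along the i-th basis vector of the j-th
   partial derivative of [F]; with row vectors, [v *m hessian F x] is H_F(x) v. *)
Definition hessian (R : realType) (n : nat) (F : 'rV[R]_n -> R)
    (x : 'rV[R]_n) : 'M[R]_n :=
  'J (gradient F) x.

(* ['D_v F] and ['J] take default values where the derivative does not exist,
   hence the two differentiability clauses. *)
Definition C2 (R : realType) (n : nat) (F : 'rV[R]_n -> R) : Prop :=
  [/\ forall x, differentiable F x,
      forall x, differentiable (gradient F) x &
      continuous (hessian F)].

Definition minimizers (R : realType) (n : nat) (F : 'rV[R]_n -> R) :
    set 'rV[R]_n :=
  [set x | forall y, F x <= F y].

Definition growth2 (R : realType) (n : nat) (mu : R) (F : 'rV[R]_n -> R) :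
    Prop :=
  minimizers F !=set0 /\
  forall xs, minimizers F xs ->
  forall x, mu / 2 * eucl_dist_set x (minimizers F) ^+ 2 <= F x - F xs.

(* [f] has derivative [l] at [t] relative to [A]: one-sided at an endpoint
   of [A], so that the values of [f] outside [A] play no role. *)
Definition is_derive_within (R : realType) (n : nat) (A : set R)
    (f : R -> 'rV[R]_n) (t : R) (l : 'rV[R]_n) : Prop :=
  (s - t)^-1 *: (f s - f t) @[s --> within A t^'] --> l.

(* [v] and [a] are the velocity and the acceleration of [x]. *)
Definition DIN_AVD_solution (R : realType) (n : nat) (alpha beta t0 : R)
    (F : 'rV[R]_n -> R) (x : R -> 'rV[R]_n) : Prop :=
  exists v a : R -> 'rV[R]_n,
    [/\ forall t, t0 <= t -> is_derive_within `[t0, +oo[ x t (v t),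
        forall t, t0 <= t -> is_derive_within `[t0, +oo[ v t (a t),
        v t0 = 0 &
        forall t, t0 <= t ->
          a t + (alpha / t) *: v t + beta *: (v t *m hessian F (x t))
            + gradient F (x t) = 0].

(* Makes the Landau notation available at [+oo]. *)
Canonical pinfty_filter_on (R : realType) :=
  FilterType (pinfty_nbhs R) (@proper_pinfty_nbhs R).

(* Main.v *)
(* In terms of w = x' + beta grad F(x), (DIN-AVD) reads w' = - (alpha/t) x' -
   grad F(x), so the Hessian disappears.  Put z = x - xs and W = F(x) - F(xs).
   Convexity (W <= <grad F(x), z>) and growth ((mu/2) |z|^2 <= W) bound both
   |z|^2 and W by constant multiples of |grad F(x)|^2.  Hence, for small d > 0,
     Phi = (1 + d beta) W + |w|^2 / 2 - d <z, w>
   satisfies W <= 2 Phi and, for t large, Phi' <= - k Phi with k > 0: the terms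
   beta |grad F(x)|^2 and d |x'|^2 dissipate everything, the terms in alpha/t
   being small.  So W decays exponentially, faster than any power of t. *)

Require Import Defs.
From mathcomp Require Import all_boot all_order all_algebra.
From mathcomp Require Import all_classical all_reals all_analysis.
From mathcomp Require Import measurable_realfun ring lra.
Import Order.TTheory GRing.Theory Num.Theory.
Import numFieldNormedType.Exports.
Local Open Scope classical_set_scope.
Local Open Scope ring_scope.

(** * The Euclidean inner product and the pointwise Lyapunov inequality *)

Definition dot {R : realType} {n : nat} (u v : 'rV[R]_n) : R :=
  \sum_(i < n) u 0 i * v 0 i.

Section Dot.
Context {R : realType} {n : nat}.
Implicit Types (u v w g z : 'rV[R]_n) (c : R).

Lemma dotC u v : dot u v = dot v u.
Proof. by apply: eq_bigr => i _; rewrite mulrC. Qed.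

Lemma dotDl u v w : dot (u + v) w = dot u w + dot v w.
Proof. by rewrite -big_split; apply: eq_bigr => i _; rewrite mxE mulrDl. Qed.

Lemma dotZl c u v : dot (c *: u) v = c * dot u v.
Proof. by rewrite /dot mulr_sumr; apply: eq_bigr => i _; rewrite mxE mulrA. Qed.

Lemma dotDr u v w : dot w (u + v) = dot w u + dot w v.
Proof. by rewrite dotC dotDl !(dotC w). Qed.

Lemma dotZr c u v : dot u (c *: v) = c * dot u v.
Proof. by rewrite dotC dotZl dotC. Qed.

Lemma dotNl u v : dot (- u) v = - dot u v.
Proof. by rewrite -scaleN1r dotZl mulN1r. Qed.

Lemma dotNr u v : dot u (- v) = - dot u v.
Proof. by rewrite dotC dotNl dotC. Qed.

Lemma dot_ge0 u : 0 <= dot u u.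
Proof. by apply: sumr_ge0 => i _; rewrite -expr2 sqr_ge0. Qed.

(** Expansion of the squared norm of [c *: u - v], which is nonnegative. *)
Lemma dot_young c u v : 2 * c * dot u v <= c ^+ 2 * dot u u + dot v v.
Proof.
have := dot_ge0 (c *: u - v).
rewrite !(dotDl, dotDr, dotZl, dotZr, dotNl, dotNr) (dotC v u); lra.
Qed.

(* The left-hand side of the last inequality is the derivative of [Phi] along
   (DIN-AVD) with [a = alpha / t]: there [w' = - a *: v - g] has no Hessian. *)
Lemma lyapunov_constants (mu beta : R) : 0 < mu -> 0 < beta ->
  exists d k a0 : R, [/\ 0 < d, 0 < k, 0 < a0 &
    forall (a W : R) g v z, 0 <= a <= a0 ->
      mu / 2 * dot z z <= W -> W <= dot g z ->
      let w := v + beta *: g in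
      let Phi := (1 + d * beta) * W + dot w w / 2 - d * dot z w in
      W <= 2 * Phi /\
      (1 + d * beta) * dot g v - a * dot v w - dot g w
        - d * dot v w + d * (a * dot z v + dot z g) <= - k * Phi].
Proof.
move=> mu0 beta0.
(* The first bound on [d] will give [d * dot g z <= beta / 2 * dot g g]; the other two give
   [d ^+ 2 <= mu / 2], hence [d ^+ 2 * dot z z <= W]. *)
pose d := Num.min (beta * mu / 4) (Num.min 1 (mu / 2)).
have d0 : 0 < d by rewrite !lt_min; apply/and3P; split; lra || nra.
have [d1 d2 d3] : [/\ d <= beta * mu / 4, d <= 1 & d <= mu / 2].
  by rewrite !ge_min !lexx !orbT.
(* [c] is chosen so that [Phi <= c * dot g g + 2 * dot v v]; then [k * Phi] is at most
   [beta / 4 * dot g g + d / 2 * dot v v]. *)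
pose c := 4 / mu + 2 * d * beta / mu + 2 * beta ^+ 2.
have c0 : 0 < c.
  by rewrite !addr_gt0 ?mulr_gt0 ?invr_gt0 ?exprn_gt0.
pose k := Num.min (beta / 4 / c) (d / 4).
have k0 : 0 < k by rewrite lt_min !divr_gt0.
have k1 : k * c <= beta / 4 by rewrite -ler_pdivlMr// ge_min lexx.
have k2 : k <= d / 4 by rewrite ge_min lexx orbT.
(* [e] dominates the coefficients of [dot g g] and [dot v v] in the bound for the error terms
   carrying the factor [a]; [a0] makes these errors small against the dissipation. *)
pose e := beta / 2 + 2 * d / mu ^+ 2 + d / 2.
have e3 : 0 < 2 * d / mu ^+ 2 by rewrite !divr_gt0 ?mulr_gt0 ?exprn_gt0.
have [e1 e2 e0] : [/\ beta / 2 + 2 * d / mu ^+ 2 <= e, beta / 2 + d / 2 <= e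
  & 0 < e] by rewrite /e; split; lra.
pose a0 := Num.min (beta / 4 / e) (d / 2 / e).
have a00 : 0 < a0 by rewrite lt_min !divr_gt0.
have a1 : a0 * e <= beta / 4 by rewrite -ler_pdivlMr// ge_min lexx.
have a2 : a0 * e <= d / 2 by rewrite -ler_pdivlMr// ge_min lexx orbT.
exists d, k, a0; split => // a W g v z /andP[a_ge0 aa0] zW Wg w Phi.
set m := mu^-1; have mm : mu * m = 1 by rewrite mulfV ?gt_eqF.
have m0 : 0 < m by rewrite invr_gt0.
have wE : w = v + beta *: g by [].
have [vw gw ww] : [/\ dot v w = dot v v + beta * dot g v,
  dot g w = dot g v + beta * dot g g &
  dot w w = dot v v + 2 * beta * dot g v + beta ^+ 2 * dot g g].
  by rewrite wE !(dotDl, dotDr, dotZl, dotZr) (dotC v g); split; ring.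
have zw1 := dot_young d z w; have zw2 := dot_young (- d) z w.
have gv1 := dot_young beta g v; have gv2 := dot_young (- 1) g v.
have zv1 := dot_young 1 z v; have zg1 := dot_young (mu / 2) z g.
rewrite vw gw (dotC z g) {vw gw}; rewrite (dotC z g) in zg1.
move: zw1 zw2 gv1 gv2 zv1 zg1 ww zW Wg; rewrite /Phi {Phi wE}.
(* From here on the inequality is scalar: [A], [B], [D], [N] are the squared norms of [g], [v], [z],
   [w], and [p], [q], [r], [s] are the products of the pairs g-v, z-v, g-z, z-w. *)
move: (dot g g) (dot v v) (dot z z) (dot g v) (dot z v) (dot g z) (dot w w)
  (dot z w) (dot_ge0 g) (dot_ge0 v) (dot_ge0 z) => A B D p q r N s A0 B0 D0.
move=> zw1 zw2 gv1 gv2 zv1 zg1 ww zW Wr.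
(* Growth and convexity give [mu ^+ 2 / 2 * D <= mu * r], while Young gives
   [mu * r <= mu ^+ 2 / 4 * D + A]; half of the [D] term is absorbed. *)
have muD : mu ^+ 2 * D <= 4 * A.
  have : mu * (mu / 2 * D) <= mu * r.
    by rewrite (ler_wpM2l (ltW mu0))// (le_trans zW).
  lra.
have mur : mu * r <= 2 * A by lra.
have rA : r <= 2 * m * A.
  rewrite -(ler_pM2l mu0).
  have -> : mu * (2 * m * A) = mu * m * (2 * A) by ring.
  by rewrite mm mul1r.
have DA : D <= 4 * m ^+ 2 * A.
  have mu2 : 0 < mu ^+ 2 by rewrite exprn_gt0.
  rewrite -(ler_pM2l mu2).
  have -> : mu ^+ 2 * (4 * m ^+ 2 * A) = (mu * m) ^+ 2 * (4 * A) by ring.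
  by rewrite mm expr1n mul1r.
have d2D : d ^+ 2 * D <= W.
  have : d ^+ 2 <= mu / 2.
    by rewrite expr2 -[leRHS]mul1r ler_pM ?(ltW d0).
  by move=> /(ler_wpM2r D0) /le_trans; apply.
have W0 : 0 <= W by apply: le_trans d2D; rewrite mulr_ge0 ?sqr_ge0.
have db0 : 0 < d * beta by rewrite mulr_gt0.
have dbW : 0 <= d * beta * W by rewrite mulr_ge0// ltW.
split; first by lra.
have PhiAB : (1 + d * beta) * W + N / 2 - d * s <= c * A + 2 * B.
  have : (2 + d * beta) * W <= (2 + d * beta) * (2 * m * A).
    by rewrite ler_pM2l ?(le_trans Wr)//; lra.
  rewrite /c -/m; lra.
(* In the derivative the terms in [p] free of [a] cancel. What remains is
   [- beta * A - d * B + d * r] plus terms with factor [a]: [d * r] costs [beta / 2 * A], the others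
   at most [beta / 4 * A + d / 2 * B]. *)
apply: (@le_trans _ _ (- (beta / 4 * A + d / 2 * B))); last first.
  rewrite mulNr lerN2.
  apply: (@le_trans _ _ (k * (c * A + 2 * B))).
    by rewrite (ler_wpM2l (ltW k0)).
  have := ler_wpM2r A0 k1; have := ler_wpM2r B0 k2; lra.
have dr : d * r <= beta / 2 * A.
  have : d * r <= d * (2 * m * A) by rewrite (ler_wpM2l (ltW d0)).
  have : d * (2 * m * A) <= beta * mu / 4 * (2 * m * A).
    by rewrite ler_wpM2r// !mulr_ge0// ltW.
  have -> : beta * mu / 4 * (2 * m * A) = beta / 2 * A * (mu * m) by field.
  rewrite mm; lra.
have aA : a * (beta / 2 + 2 * d * m ^+ 2) <= beta / 4.
  apply: le_trans a1; rewrite ler_pM//; last by rewrite /m exprVn.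
  by rewrite ltW// addr_gt0 ?divr_gt0 ?mulr_gt0 ?mulr_gt0 ?exprn_gt0.
have aB : a * (beta / 2 + d / 2) <= d / 2.
  by apply: le_trans a2; rewrite ler_pM// ltW// addr_gt0 ?divr_gt0.
have := ler_wpM2r A0 aA; have := ler_wpM2r B0 aB.
have : a * beta * (- 2 * p) <= a * beta * (A + B).
  by apply: ler_wpM2l; [rewrite mulr_ge0 ?(ltW beta0) ?(ltW d0)|lra].
have : a * d * (2 * q) <= a * d * (4 * m ^+ 2 * A + B).
  by apply: ler_wpM2l; [rewrite mulr_ge0 ?(ltW beta0) ?(ltW d0)|lra].
have : 0 <= a * B by rewrite mulr_ge0.
lra.
Qed.
End Dot.

(** * Derivatives along curves, ordinary and relative to a set *)

Lemma is_derive_entry {R : realType} {n : nat} (f : R -> 'rV[R]_n) (t : R)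
    (df : 'rV[R]_n) (i : 'I_n) :
  is_derive t 1 f df -> is_derive t 1 (fun s => f s 0 i) (df 0 i).
Proof.
move=> [ft <-]; rewrite derive_mx// mxE.
by apply/derivableP; move/derivable_mxP : ft.
Qed.

Lemma is_derive_dot {R : realType} {n : nat} (f g : R -> 'rV[R]_n) (t : R)
    (df dg : 'rV[R]_n) :
  is_derive t 1 f df -> is_derive t 1 g dg ->
  is_derive t 1 (fun s => dot (f s) (g s)) (dot df (g t) + dot (f t) dg).
Proof.
move=> ft gt; rewrite /dot -big_split/=.
rewrite [X in is_derive _ _ X](_ : _ =
    \sum_(i < n) (fun s => f s 0 i) * (fun s => g s 0 i)); last first.
  by apply/funext => s; rewrite fct_sumE; apply: eq_bigr.
apply: is_derive_sum => i.
have fi := is_derive_entry _ _ _ i ft; have gi := is_derive_entry _ _ _ i gt.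
apply: is_derive_eq; rewrite addrC; congr (_ + _).
by rewrite /GRing.scale/= mulrC.
Qed.

Lemma is_derive_comp {R : realType} (V W : normedModType R) (F : V -> W)
    (f : R -> V) (t : R) (df : V) :
  differentiable F (f t) -> is_derive t 1 f df ->
  is_derive t 1 (F \o f) ('D_df F (f t)).
Proof.
move=> dF [ft <-]; have dft : differentiable f t by exact/derivable1_diffP.
apply: DeriveDef; first exact/derivable1_diffP/differentiable_comp.
by rewrite !deriveE//; [rewrite diff_comp|exact: differentiable_comp].
Qed.

(** Linearity of the differential, with [d] expanded in the standard basis. *)
Lemma derive_gradient {R : realType} {n : nat} (F : 'rV[R]_n -> R)
    (p d : 'rV[R]_n) :
  differentiable F p -> 'D_d F p = dot (gradient F p) d.
Proof.
move=> dF; rewrite deriveE// [in LHS](row_sum_delta d) linear_sum.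
apply: eq_bigr => i _.
by rewrite linearZ/= mxE deriveE// mulrC.
Qed.

(** Near an interior point the restriction to [A] is vacuous. This gives ordinary derivatives of a
    solution at all times after [t0]. *)
Lemma is_derive_within_interior {R : realType} {n : nat} (A : set R)
    (f : R -> 'rV[R]_n) (t : R) (l : 'rV[R]_n) :
  A° t -> is_derive_within A f t l -> is_derive t 1 f l.
Proof.
move=> At fl.
have cvf : h^-1 *: (f (h *: 1 + t) - f t) @[h --> 0^'] --> l.
  apply/cvgrPdist_lt => e e0.
  move/cvgrPdist_lt : fl => /(_ e e0); rewrite !near_withinE => fl.
  have {fl} : \forall s \near t, s != t -> `|l - (s - t)^-1 *: (f s - f t)| < e.
    near=> s => st; apply: (near fl s) => //.
    by apply: (near At s).
  rewrite (near_shift 0); apply: filterS => h /=.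
  rewrite subr0 addrK [h *: _]mulr1 => fl h0; apply: fl.
  by rewrite -subr_eq0 addrK.
by split; [apply/cvg_ex; exists l|exact/cvg_lim].
Unshelve. all: by end_near. Qed.

(** [f s] is [s - t] times the difference quotient, plus [f t]. This covers the endpoint [t0], where
    only a one-sided derivative is given. *)
Lemma is_derive_within_cvg {R : realType} {n : nat} (A : set R)
    (f : R -> 'rV[R]_n) (t : R) (l : 'rV[R]_n) :
  is_derive_within A f t l -> f s @[s --> within A (nbhs t)] --> f t.
Proof.
move=> fl.
have FF : Filter (within A t^') by apply: within_filter.
have : (s - t) *: ((s - t)^-1 *: (f s - f t)) + f t @[s --> within A t^'] --> f t.
  suff : (s - t) *: ((s - t)^-1 *: (f s - f t)) + f t
      @[s --> within A t^'] --> 0 *: l + f t by rewrite scale0r add0r.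
  apply: cvgD; last exact: cvg_cst.
  apply: cvgZ => //; apply: cvg_within_filter; apply: cvg_within_filter.
  suff : s - t @[s --> t] --> t - t by rewrite subrr.
  by apply: cvgB; [exact: cvg_id|exact: cvg_cst].
move/cvgrPdist_lt => ft; apply/cvgrPdist_lt => e e0.
move: (ft e e0); rewrite !near_withinE; apply: filterS => s + As.
have [->|st] := eqVneq s t; first by move=> _; rewrite subrr normr0.
by move=> /(_ isT As); rewrite scalerA mulfV ?subr_eq0// scale1r subrK.
Qed.

(** * Pointwise consequences of convexity and growth *)

(** For [0 < h <= 1] convexity bounds the difference quotient from [p] towards [q] by [F q - F p];
    let [h] decrease to 0. *)
Lemma convex_function_gradient {R : realType} {n : nat} (F : 'rV[R]_n -> R)
    (p q : 'rV[R]_n) :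
  convex_function [set: 'rV[R]_n] F -> differentiable F p ->
  F p + dot (gradient F p) (q - p) <= F q.
Proof.
move=> cF dF; rewrite addrC -lerBrDr -derive_gradient//.
have dFq : h^-1 *: (F (h *: (q - p) + p) - F p) @[h --> 0^'+]
    --> 'D_(q - p) F p.
  by apply: cvg_dnbhs_at_right; exact: (diff_derivable (v := q - p) dF).
rewrite -(cvg_lim _ dFq)//; apply: limr_le.
  by apply/cvg_ex; exists ('D_(q - p) F p).
near=> h.
have h0 : 0 < h by [].
have h1 : h <= 1 by near: h; apply: nbhs_right_le.
have := cF (Itv01 (ltW h0) h1) q p (in_setT _) (in_setT _).
rewrite convRE /conv/= /unstable.onem => Fh.
rewrite ler_pdivrMl//; move: Fh.
have -> : h *: q + (1 - h) *: p = h *: (q - p) + p.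
  by rewrite scalerBr scalerBl scale1r addrA addrAC.
lra.
Unshelve. all: by end_near. Qed.

Lemma growth2_dot {R : realType} {n : nat} (mu : R) (F : 'rV[R]_n -> R)
    (xs p : 'rV[R]_n) :
  minimizers F = [set xs] -> growth2 mu F ->
  mu / 2 * dot (p - xs) (p - xs) <= F p - F xs.
Proof.
move=> Fxs [_ /(_ xs)]; rewrite Fxs => /(_ erefl p).
rewrite /eucl_dist_set image_set1 inf1 /eucl_norm sqr_sqrtr.
  by under eq_bigr do rewrite expr2.
by apply: sumr_ge0 => i _; rewrite sqr_ge0.
Qed.

(** * Exponentials: Gronwall decay, comparison with powers, integrability *)

Lemma is_derive_expRM {R : realType} (k u : R) :
  is_derive u 1 (fun v => expR (k * v)) (expR (k * u) * k).
Proof.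
apply: (@is_derive1_comp _ expR (fun v => k * v)).
by apply: is_derive_eq; rewrite /GRing.scale/= mulr1.
Qed.

Lemma continuous_expRM {R : realType} (k : R) :
  continuous (fun v : R => expR (k * v)).
Proof.
move=> v; apply: (@continuous_comp _ _ _ (fun v => k * v) expR).
  exact: mulrl_continuous.
exact: continuous_expR.
Qed.

(** The product [expR (k * t) * f t] has nonpositive derivative, hence is nonincreasing. *)
Lemma gronwall_decay {R : realType} (f df : R -> R) (k a : R) :
  (forall t, a < t -> is_derive t 1 f (df t)) ->
  (forall t, a < t -> df t <= - k * f t) ->
  forall s t, a < s -> s <= t -> f t <= f s * expR (- k * (t - s)).
Proof.
move=> fdf dfle s t as_ st.
pose g u := expR (k * u) * f u.
have dg u : a < u -> is_derive u 1 g (expR (k * u) * (df u + k * f u)).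
  move=> au; have fu := fdf u au.
  have eu := is_derive_expRM k u.
  apply: is_derive_eq; rewrite /GRing.scale/=; ring.
have gle : g t <= g s.
  apply: (@ler0_derive1_nincry _ g s) => // [u|u|].
  - by rewrite in_itv/= andbT => su; have [] := dg u (lt_trans as_ su).
  - rewrite in_itv/= andbT => su; have dgu := dg u (lt_trans as_ su).
    rewrite derive1E derive_val pmulr_rle0 ?expR_gt0//.
    by have := dfle u (lt_trans as_ su); lra.
  - apply: derivable_within_continuous => u; rewrite in_itv/= andbT => su.
    by have [] := dg u (lt_le_trans as_ su).
move: gle; rewrite /g -ler_pdivlMl ?expR_gt0// -expRN mulrA -expRD mulrC.
by congr (_ <= _ * expR _); ring.
Qed.

(** Raise [y <= expR y], with [y = c * u / p], to the power [p]. *)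
Lemma powR_le_expR {R : realType} (p c u : R) : 0 < p -> 0 < c -> 0 <= u ->
  u `^ p <= (p / c) `^ p * expR (c * u).
Proof.
move=> p0 c0 u0; have pc0 : 0 < p / c by rewrite divr_gt0.
have -> : expR (c * u) = expR (c * u / p) `^ p.
  by rewrite -expRM mulfVK ?gt_eqF.
rewrite -powRM ?expR_ge0 ?(ltW pc0)//.
rewrite ge0_ler_powR ?nnegrE ?mulr_ge0 ?expR_ge0 ?invr_ge0 ?(ltW p0) ?(ltW c0)//.
rewrite -ler_pdivrMl// invf_div mulrAC.
by apply: le_trans (expR_ge1Dx _); rewrite lerDr.
Qed.

Lemma integral_expR_lty {R : realType} (a c K : R) : 0 < c -> 0 <= K ->
  (\int[lebesgue_measure]_(u in `[a, +oo[) (K * expR (- c * u))%:E < +oo)%E.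
Proof.
move=> c0 K0.
have dG (u : R) :
    is_derive u 1 (fun v => - (K / c) * expR (- c * v)) (K * expR (- c * u)).
  have eu := is_derive_expRM (- c) u.
  by apply: is_derive_eq; rewrite /GRing.scale/=; field; rewrite gt_eqF.
(* The primitive tends to 0 at infinity, so the integral is a finite difference of two values. *)
rewrite (@ge0_continuous_FTC2y _ _ (fun v => - (K / c) * expR (- c * v)) _ 0).
- by rewrite -EFinB ltry.
- by move=> u _; rewrite mulr_ge0 ?expR_ge0.
- apply: continuous_subspaceT => v.
  by apply: cvgM; [exact: cvg_cst|exact: continuous_expRM].
- rewrite -(mulr0 (- (K / c))); apply: cvgM; first exact: cvg_cst.
  have : expR (- (c * v)) @[v --> +oo] --> (0 : R).
    apply: (@cvg_comp _ _ _ (fun v => c * v) (fun v => expR (- v))).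
      exact: gt0_cvgMry.
    exact: cvgr_expR.
  by under eq_fun do rewrite -mulNr.
- by move=> u _; have [] := dG u.
- apply: cvg_at_right_filter; apply: cvgM; [exact: cvg_cst|exact: continuous_expRM].
- by move=> u _; rewrite derive1E; have := dG u => dGu; rewrite derive_val.
Qed.

(** * The Lyapunov function along a trajectory *)

Lemma DIN_AVD_exponential_decay (R : realType) (n : nat) (F : 'rV[R]_n -> R)
    (xs : 'rV[R]_n) (mu alpha beta t0 : R) (x : R -> 'rV[R]_n) :
  convex_function [set: 'rV[R]_n] F ->
  (forall p, differentiable F p) ->
  (forall p, differentiable (gradient F) p) ->
  minimizers F = [set xs] ->
  0 < mu -> growth2 mu F ->
  0 < t0 -> 0 <= alpha -> 0 < beta ->
  DIN_AVD_solution alpha beta t0 F x ->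
  exists k C T : R, [/\ 0 < k, 0 < T &
    forall t, T <= t -> F (x t) - F xs <= C * expR (- k * t)].
Proof.
move=> cF dF dgF Fxs mu0 Fgrowth t0_gt0 alpha0 beta0 [v [a [xv va _ ode]]].
have itvI t : t0 < t -> (`[t0, +oo[%classic : set R)° t.
  move=> t0t; have : `]t0, +oo[%classic `<=` (`[t0, +oo[%classic : set R)°.
    rewrite -open_subsetE; last exact: interval_open.
    by move=> s /=; rewrite !in_itv/= !andbT; exact: ltW.
  by apply; rewrite /= in_itv/= t0t.
pose G t := gradient F (x t).
pose w t := v t + beta *: G t.
have dx t : t0 < t -> is_derive t 1 x (v t).
  by move=> t0t; apply: is_derive_within_interior (itvI _ t0t) (xv _ (ltW t0t)).
have dv t : t0 < t -> is_derive t 1 v (a t).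
  by move=> t0t; apply: is_derive_within_interior (itvI _ t0t) (va _ (ltW t0t)).
have dz t : t0 < t -> is_derive t 1 (fun s => x s - xs) (v t).
  move=> /dx xt; rewrite -[X in is_derive _ _ _ X]subr0.
  exact: is_deriveB.
have dw t : t0 < t -> is_derive t 1 w (- ((alpha / t) *: v t) - G t).
  move=> t0t; have vt := dv t t0t.
  have Gt : is_derive t 1 G (v t *m hessian F (x t)).
    rewrite -(deriveEjacobian (v t) (dgF (x t))).
    exact: (is_derive_comp _ _ (gradient F) x t (v t) (dgF _) (dx t t0t)).
  have wt : is_derive t 1 w (a t + beta *: (v t *m hessian F (x t))).
    exact: is_deriveD.
  apply: is_derive_eq wt _.
  (* Moving everything to one side leaves exactly the left-hand side of the equation of motion. *)
  apply/eqP; rewrite -opprD -addr_eq0 addrACA addrA.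
  exact/eqP/ode/ltW.
have dW t : t0 < t ->
    is_derive t 1 (fun s => F (x s) - F xs) (dot (G t) (v t)).
  move=> t0t; rewrite -[X in is_derive _ _ _ X]subr0; apply: is_deriveB.
  rewrite -(derive_gradient F (x t) (v t) (dF _)).
  exact: (is_derive_comp _ _ F x t (v t) (dF _) (dx t t0t)).
have [d [k [a0 [d0 k0 a00 lyap]]]] := lyapunov_constants (n := n) mu beta mu0 beta0.
pose Phi t := (1 + d * beta) * (F (x t) - F xs) + dot (w t) (w t) / 2
  - d * dot (x t - xs) (w t).
pose dPhi t := (1 + d * beta) * dot (G t) (v t) - alpha / t * dot (v t) (w t)
  - dot (G t) (w t) - d * dot (v t) (w t)
  + d * (alpha / t * dot (x t - xs) (v t) + dot (x t - xs) (G t)).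
have Phi' t : t0 < t -> is_derive t 1 Phi (dPhi t).
  move=> t0t.
  have Wt := dW t t0t.
  have wwt := is_derive_dot _ _ _ _ _ (dw t t0t) (dw t t0t).
  have zwt := is_derive_dot _ _ _ _ _ (dz t t0t) (dw t t0t).
  have H := is_deriveB (is_deriveD (is_deriveZ (1 + d * beta) Wt)
    (is_deriveZ 2^-1 wwt)) (is_deriveZ d zwt).
  have -> : Phi = ((1 + d * beta) \*: (fun s => F (x s) - F xs)
      + 2^-1 \*: (fun s => dot (w s) (w s))
      - d \*: (fun s => dot (x s - xs) (w s))) :> (R -> R).
    by apply/funext => s; rewrite /Phi /= /GRing.scale/= [_ / 2]mulrC.
  apply: is_derive_eq H _; rewrite /dPhi /GRing.scale/=.
  move: (w t) (G t) (v t) (x t - xs) => wt Gt vt zt.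
  rewrite !(dotDl, dotDr, dotZl, dotZr, dotNl, dotNr).
  by rewrite (dotC wt vt) (dotC wt Gt); field; rewrite gt_eqF// (lt_trans t0_gt0).
(* Past [alpha / a0] the damping [alpha / t] is at most [a0]; the added 1 puts [T] strictly after
   [t0], where derivatives are two-sided. *)
pose T := Num.max t0 (alpha / a0) + 1.
have [t0T aT] : t0 < T /\ alpha / a0 <= T.
  by split; [rewrite ltr_pwDr// le_max lexx|rewrite ler_wpDr// le_max lexx orbT].
have lyapT t : T <= t ->
    F (x t) - F xs <= 2 * Phi t /\ dPhi t <= - k * Phi t.
  move=> Tt; apply: lyap.
  - have t_gt0 : 0 < t by rewrite (lt_le_trans t0_gt0)// ltW// (lt_le_trans t0T).
    apply/andP; split; first by rewrite divr_ge0// ltW.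
    by rewrite ler_pdivrMr// -ler_pdivrMl// mulrC (le_trans aT).
  - exact: growth2_dot.
  - have := convex_function_gradient F (x t) xs cF (dF _).
    by rewrite -opprB dotNr -/(G t); lra.
(* Gronwall needs a starting time strictly after [T], here [T + 1]; its factor [expR (k * (T + 1))]
   goes into the constant. *)
exists k, (2 * Phi (T + 1) * expR (k * (T + 1))), (T + 1).
have T1 : T < T + 1 by rewrite ltrDl.
have T_gt0 : 0 < T by exact: lt_trans t0T.
split => //; first exact: lt_trans T1.
move=> t Tt; apply: le_trans (lyapT t (le_trans (ltW T1) Tt)).1 _.
rewrite -!mulrA ler_pM2l// -expRD.
have -> : k * (T + 1) + - k * t = - k * (t - (T + 1)) by ring.
apply: (gronwall_decay _ dPhi _ T) => //.
- by move=> s /(lt_trans t0T)/Phi'.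
- by move=> s /ltW/lyapT[].
Qed.

(** * From exponential decay to the power rate and the integral *)

Theorem theorem2 (R : realType) (n : nat) (F : 'rV[R]_n -> R)
    (xs : 'rV[R]_n) (mu alpha beta t0 : R) (x : R -> 'rV[R]_n)
    (F_convex : convex_function [set: 'rV[R]_n] F)
    (F_C2 : C2 F)
    (xs_unique : minimizers F = [set xs])
    (mu_gt0 : 0 < mu)
    (F_growth : growth2 mu F)
    (t0_gt0 : 0 < t0)
    (alpha_ge3 : 3 <= alpha)
    (beta_gt0 : 0 < beta)
    (x_sol : DIN_AVD_solution alpha beta t0 F x) :
  forall eps : R, 0 < eps < 1 ->
    ((fun t : R => F (x t) - F xs) =O_ (pinfty_nbhs R)
       (fun t : R => t `^ (- alpha + eps))) /\
    (\int[lebesgue_measure]_(u in `[t0, +oo[)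
       (u `^ (alpha - eps) * (F (x u) - F xs))%:E < +oo)%E.
Proof.
move=> eps /andP[eps0 eps1].
have [dF dgF _] := F_C2.
have alpha0 : 0 <= alpha by lra.
have [k [C [T [k0 T0 decay]]]] := DIN_AVD_exponential_decay _ _ F xs mu alpha beta
  t0 x F_convex dF dgF xs_unique mu_gt0 F_growth t0_gt0 alpha0 beta_gt0 x_sol.
have W0 t : 0 <= F (x t) - F xs.
  have : minimizers F xs by rewrite xs_unique.
  by rewrite subr_ge0; exact.
set p := alpha - eps; have p0 : 0 < p by rewrite /p; lra.
have pE : - alpha + eps = - p by rewrite /p; ring.
pose c := k / 2; have c0 : 0 < c by rewrite divr_gt0.
pose f t := t `^ p * (F (x t) - F xs).
have f0 t : 0 <= f t by rewrite mulr_ge0 ?powR_ge0.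
have f_decay : exists2 K, 0 <= K & forall t, T <= t -> f t <= K * expR (- c * t).
  (* The sign of [C] is unknown; its absolute value keeps the constant nonnegative. *)
  exists ((p / c) `^ p * `|C|) => [|t Tt]; first by rewrite mulr_ge0 ?powR_ge0.
  have t_ge0 : 0 <= t by rewrite (le_trans (ltW T0)).
  have : f t <= (p / c) `^ p * expR (c * t) * (`|C| * expR (- k * t)).
    rewrite ler_pM ?powR_ge0 ?powR_le_expR// (le_trans (decay t Tt))//.
    by rewrite ler_wpM2r ?expR_ge0// ler_norm.
  rewrite mulrACA -expRD; have -> // : c * t + - k * t = - c * t.
  by rewrite /c; field.
have [K K0 fK] := f_decay; split.
  (* The Landau constant must be positive, whereas [K] may vanish. *)
  apply/eqO_exP; exists (K + 1); first by rewrite ltr_pwDr.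
  near=> t; have Tt : T <= t by near: t; apply: nbhs_pinfty_ge; exact: num_real.
  have t_gt0 : 0 < t by rewrite (lt_le_trans T0).
  rewrite ger0_norm// ger0_norm ?powR_ge0// pE powRN ler_pdivlMr ?powR_gt0//.
  rewrite mulrC; apply: le_trans (fK t Tt) _.
  rewrite (@le_trans _ _ (K * 1)) ?ler_wpM2l//; last by rewrite mulr1 lerDl.
  by rewrite -expR0 ler_expR mulNr oppr_le0 mulr_ge0 ?ltW.
have [v [a [xv _ _ _]]] := x_sol.
(* Continuity up to [t0] serves twice: for a maximum on a compact interval and for measurability. *)
have cf : {within `[t0, +oo[, continuous f}.
  apply/subspace_continuousP => t t0t.
  have t_ge : t0 <= t by move: t0t; rewrite /= in_itv/= andbT.
  have tgt0 : 0 < t by exact: lt_le_trans t0_gt0 t_ge.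
  apply: cvgM.
    apply: cvg_within_filter.
    apply: (@differentiable_continuous _ _ _ t (fun u : R => u `^ p)).
    apply/derivable1_diffP.
    by have [] := @is_derive1_powR _ p t tgt0.
  apply: cvgB; last exact: cvg_cst.
  apply: (@cvg_comp _ _ _ x F _ _ _ _ (differentiable_continuous (dF (x t)))).
  exact: is_derive_within_cvg (xv t t_ge).
(* The exponential bound is extended down to [t0]: on [[t0, T1]] the maximum of [f] times
   [expR (c * T1)] compensates the factor [expR (- c * t)]. *)
have [K' K'0 fK'] : exists2 K', 0 <= K' &
    forall t, t0 <= t -> f t <= K' * expR (- c * t).
  pose T1 := Num.max t0 T.
  have t0T1 : t0 <= T1 by rewrite le_max lexx.
  have [|s _ fmax] := @EVT_max _ f t0 T1 t0T1.
    exact/(continuous_subspaceW _ cf)/subset_itvl.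
  exists (Num.max K (f s * expR (c * T1))); first by rewrite le_max K0.
  move=> t t0t; have [tT1|T1t] := leP t T1; last first.
    have Tt : T <= t by rewrite (le_trans _ (ltW T1t))// le_max lexx orbT.
    by rewrite (le_trans (fK t Tt))// ler_wpM2r ?expR_ge0// le_max lexx.
  have ft : f t <= f s by apply: fmax; rewrite in_itv/= t0t.
  apply: (@le_trans _ _ (f s * expR (c * T1) * expR (- c * t))).
    rewrite -mulrA -expRD (le_trans ft)// ler_peMr// -expR0 ler_expR.
    by rewrite mulNr -mulrBr mulr_ge0 ?subr_ge0// ltW.
  by rewrite ler_wpM2r ?expR_ge0// le_max lexx orbT.
apply: le_lt_trans (integral_expR_lty t0 c K' c0 K'0).
apply: ge0_le_integral => //.
- by move=> t _; rewrite lee_fin; exact: f0.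
- apply/measurable_EFinP; exact: subspace_continuous_measurable_fun.
- apply/measurable_EFinP; apply: measurable_funTS.
  apply: continuous_measurable_fun => t.
  by apply: cvgM; [exact: cvg_cst|exact: continuous_expRM].
- move=> t; rewrite /= in_itv/= andbT => t0t; rewrite lee_fin; exact: fK'.
Unshelve. all: by end_near.
Qed.
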